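(* Let $N>2$ be an integer and let $\chi:(\mathbb{Z}/N\mathbb{Z})^\times\to\mathbb{C}^\times$ be any Dirichlet character. For every integer $n\ge 2$ satisfying $\chi(-1)=(-1)^n$, $$L(n,\chi)=\frac{\pi^n}{2(n-1)!\,N^n}\sum_{m=1}^{N}\frac{\chi(m)}{\sin^n(m\pi/N)}\sum_{l=1}^{n-1}\cos\Big(\frac{(n-2l)m\pi}{N}\Big)\overline{A}(n,l).$$ If $n=1$ and $\chi$ is odd (i.e. $\chi(-1)=-1$), then $$L(1,\chi)=\frac{\pi}{2N}\sum_{m=1}^{N}\chi(m)\cot\Big(\frac{m\pi}{N}\Big).$$
   Context: The character $\chi$ is extended to $\mathbb{Z}$ by $\chi(m)=0$ if $\gcd(m,N)>1$, and is not assumed primitive. Terms with $\chi(m)=0$ (in particular $m=N$) are interpreted as $0$. $L(s,\chi)=\sum_{k=1}^\infty\chi(k)k^{-s}$ is the Dirichlet $L$-function (for $s=1$ and $\chi$ odd, the convergent series, equivalently the value of the analytic continuation). A circular $n$-permutation is an arrangement $\sigma=(\sigma(1),\dots,\sigma(n))$ of $\{1,\dots,n\}$ on a circle, considered up to rotation; with $\sigma(n+1)=\sigma(1)$, a descent of $\sigma$ is an entry $\sigma(i)$, $1\le i\le n$, with $\sigma(i)>\sigma(i+1)$. $\overline{A}(n,l)$ denotes the number of circular $n$-permutations with exactly $l$ descents. *)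

(* Defs.v *)
From HB Require Import structures.
From mathcomp Require Export all_boot all_order all_algebra all_fingroup.
From mathcomp Require Export complex.
From mathcomp Require Export all_classical all_reals all_analysis.

Set Implicit Arguments.
Unset Strict Implicit.
Unset Printing Implicit Defensive.

Export Order.TTheory GRing.Theory Num.Theory.
Export numFieldNormedType.Exports.

#[global] Open Scope complex_scope.
#[global] Open Scope ring_scope.

(* A Dirichlet character (Z/NZ)^* -> C^*, for N > 1 ('Z_N is Z/NZ only then). *)
Definition dirichlet_character (R : realType) (N : nat)
    (chi : {unit 'Z_N} -> R[i]) : Prop :=
  (forall u v : {unit 'Z_N}, chi (u * v)%g = chi u * chi v) /\
  (forall u : {unit 'Z_N}, chi u != 0).

(* Extension to the integers: [insub] returns the residue of m as an element of
   {unit 'Z_N} when gcd(m, N) = 1, and None otherwise. *)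
Definition char_ext (R : realType) (N : nat)
    (chi : {unit 'Z_N} -> R[i]) (m : int) : R[i] :=
  oapp chi 0 (insub (m%:~R : 'Z_N)).

(* Partial sums of \sum_(k >= 1) chi(k) k^-s at a natural number s; the index
   is shifted since sequences start at 0. R[i]^o is R[i] with its usual
   topology, given by the modulus. *)
Definition dirichlet_series (R : realType) (N : nat)
    (chi : {unit 'Z_N} -> R[i]) (s : nat) : (R[i]^o)^nat :=
  [series char_ext chi k.+1%:Z / k.+1%:R ^+ s]_k.

(* Meaningful only where [dirichlet_series chi s] converges. *)
Definition dirichlet_L (R : realType) (N : nat)
    (chi : {unit 'Z_N} -> R[i]) (s : nat) : R[i] :=
  limn (dirichlet_series chi s).

Definition cot (R : realType) (x : R) : R := cos x / sin x.

(* Arrangements of 0, ..., n-1 (instead of 1, ..., n) are permutations of 'I_n;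
   ordS is the cyclic successor on positions. *)
Definition circular_descents (n : nat) (s : 'S_n) : nat :=
  #|[set i : 'I_n | (s (ordS i) < s i)%N]|.

Definition rotation (n : nat) : 'S_n := perm (@ordS_inj n).

(* The product of permutations is (r * s) i = s (r i), so the right coset
   <[rotation n]> :* s consists of all the rotations of s, and the right cosets
   of <[rotation n]> are the circular n-permutations. The number of descents is
   constant on each of them. *)
Definition circular_eulerian (n l : nat) : nat :=
  #|rcosets <[rotation n]>%g [set s : 'S_n | circular_descents s == l]|.

(* Main.v *)
Require Import Defs.
From mathcomp Require Import ring lra zify.

(* The number of descents splits the n gaps of a circular n-arrangement into
   those that keep and those that increase it when a new maximum is inserted;
   the resulting recurrence for circular Eulerian numbers is exactly the one
   obeyed by the coefficients of the derivatives of the cotangent. Hence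
   pi^n / ((n-1)! sin(pi x)^n) \sum_l cos((n-2l) pi x) A(n, l) is
   (-1)^(n-1) / (n-1)! times the (n-1)-st derivative of pi cot(pi x). The
   lattice sum \sum_k (x+k)^-n satisfies the same differential recurrence. The
   two agree for n = 2 by iterating the duplication formula
   4 / sin(2y)^2 = 1 / sin(y)^2 + 1 / cos(y)^2 and comparing 1 / sin(y)^2 with
   1 / y^2 for |y| <= pi / 2, then for n = 1 since their difference has zero
   derivative and vanishes at 1/2, then for all n by differentiation. Finally the
   parity of chi folds twice the L-series into lattice sums at the points m/N. *)

Set Implicit Arguments.
Unset Strict Implicit.
Unset Printing Implicit Defensive.

(** * Circular permutations *)

Lemma rotationX n k (i : 'I_n) : (rotation n ^+ k)%g i = ((i + k) %% n)%N :> nat.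
Proof.
elim: k => [|k IH]; first by rewrite expg0 perm1 addn0 modn_small.
by rewrite expgSr permM permE /= IH -addn1 modnDml addn1 addnS.
Qed.

Lemma circular_descents_sum n (s : 'S_n) :
  circular_descents s = (\sum_i (s (ordS i) < s i))%N.
Proof.
by rewrite /circular_descents -sum1dep_card big_mkcond; apply: eq_bigr => i _;
   case: ltnP.
Qed.

Lemma circular_descents_rotate n k (s : 'S_n) :
  circular_descents (rotation n ^+ k * s)%g = circular_descents s.
Proof.
elim: k => [|k IH]; first by rewrite expg0 mul1g.
rewrite expgS -mulgA -[RHS]IH; set t := (_ * s)%g.
rewrite !circular_descents_sum [RHS](reindex_inj (@ordS_inj n)).
by apply: eq_bigr => i _; rewrite !permM !permE.
Qed.

(* Every circular permutation has exactly one arrangement with 0 in position 0. *)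
Definition anchored n : {set 'S_n.+1} :=
  [set s : 'S_n.+1 | s ord0 == ord0].

Lemma circular_eulerianE n l :
  circular_eulerian n.+1 l =
  #|[set s : 'S_n.+1 in anchored n | circular_descents s == l]|.
Proof.
rewrite /circular_eulerian -(@card_in_imset _ _ (rcoset <[rotation n.+1]>%g)).
  apply: eq_card => X; apply/imsetP/imsetP => -[s]; rewrite inE => hs ->.
    (* [k] is the position of the entry 0, which rotating by [k] brings to position 0. *)
    pose k := (s^-1)%g ord0.
    exists (rotation n.+1 ^+ k * s)%g; last first.
      rewrite !rcosetE; apply/rcoset_eqP/rcosetP; exists (rotation n.+1 ^- k)%g.
        by rewrite groupV mem_cycle.
      by rewrite mulKg.
    rewrite !inE circular_descents_rotate hs andbT permM.
    suff -> : (rotation n.+1 ^+ k)%g ord0 = k by rewrite permKV.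
    by apply: val_inj; rewrite /= rotationX add0n modn_small.
  by exists s => //; rewrite inE; case/andP: hs.
(* Uniqueness: a rotation by k between two anchored arrangements fixes position 0, so n + 1 divides
   k. *)
move=> s t; rewrite !inE => /andP[/eqP s0 _] /andP[/eqP t0 _].
rewrite !rcosetE => /rcoset_eqP/rcosetP[_ /cycleP[k ->] e].
move: s0; rewrite e permM -{2}t0 => /perm_inj/(congr1 val) /=.
rewrite rotationX add0n => k0.
suff -> : (rotation n.+1 ^+ k = 1)%g by rewrite mul1g.
apply/permP => i; apply: val_inj; rewrite perm1 /= rotationX.
by rewrite -modnDmr k0 addn0 modn_small.
Qed.

Lemma ordS_neq n (p : 'I_n.+2) : ordS p != p.
Proof.
apply/eqP => /(congr1 val) /=; have := ltn_ord p.
rewrite ltnS leq_eqVlt => /predU1P[->|lt]; first by rewrite modnn.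
by rewrite modn_small// => /eqP; rewrite -[X in _ == X]addn0 -addn1 eqn_add2l.
Qed.

(** The new position [lift ord0 q] is q + 1: it opens the gap after q, and [lift] renumbers the old
    positions around it. Only the successor of q changes; the next lemma treats the other
    positions. *)
Lemma ordS_lift_id n (q : 'I_n.+1) :
  ordS (lift (lift ord0 q) q) = lift ord0 q.
Proof.
apply: val_inj; rewrite /= /bump leq0n add1n ltnn add0n modn_small//.
by rewrite ltnS ltn_ord.
Qed.

Lemma ordS_lift n (q k : 'I_n.+1) : k != q ->
  ordS (lift (lift ord0 q) k) = lift (lift ord0 q) (ordS k).
Proof.
move=> kq; apply: val_inj; rewrite /= /bump leq0n add1n.
have := ltn_ord k; rewrite ltnS leq_eqVlt => /predU1P[kn|lt]; last first.
  rewrite (@modn_small k.+1)//; have [qk|kq'] := ltnP q k.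
    by rewrite (ltnW (_ : _ < _)%N)// modn_small ?add1n.
  rewrite add0n ltnS (leqNgt q) ltn_neqAle kq' (contraNneq _ kq)//=.
    by rewrite add0n modn_small// !ltnS ltnW.
  by move=> e; apply/eqP/val_inj.
have qk : (q < k)%N.
  rewrite ltn_neqAle [X in _ && (_ <= X)%N]kn -ltnS ltn_ord andbT.
  by apply: contraNneq kq => e; apply/eqP/val_inj.
by rewrite qk kn add1n !modnn.
Qed.

(** The gap after q gives way to two: the step up to the new maximum, never a descent, and the step
    down from it, always one. All other gaps keep their end entries. *)
Lemma circular_descents_insert n (s : 'S_n.+1) (q : 'I_n.+1) :
  (circular_descents (lift_perm (lift ord0 q) ord_max s) +
   (s (ordS q) < s q) = (circular_descents s).+1)%N.
Proof.
set p := lift ord0 q; set t := lift_perm _ _ _.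
rewrite !circular_descents_sum (bigD1_ord p)//= lift_perm_id.
have -> : (t (ordS p) < n.+1)%N.
  have : t (ordS p) != t p by rewrite (inj_eq perm_inj) ordS_neq.
  by rewrite lift_perm_id ltn_neqAle -ltnS ltn_ord andbT.
rewrite (bigD1 q)//= ordS_lift_id lift_perm_id /= ltnNge leq_ord add0n.
rewrite [in RHS](bigD1 q)//= addnC addnCA add1n; congr (_ + _).+1.
apply: eq_bigr => k kq; rewrite ordS_lift// !lift_perm_lift /= !/bump /=.
by rewrite !(leqNgt n.+1) !ltn_ord.
Qed.

Lemma lift_perm_bij n (j : 'I_n.+1) :
  bijective (fun x : 'S_n * 'I_n.+1 => lift_perm x.2 j x.1).
Proof.
apply: inj_card_bij; last first.
  by rewrite card_prod card_ord !card_Sn factS mulnC.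
move=> [s p] [t q] /= e.
have epq : p = q.
  by apply: (@perm_inj _ (lift_perm p j s)); rewrite {2}e !lift_perm_id.
rewrite -epq in e *; congr pair; apply/permP => k.
apply: (@lift_inj _ j); rewrite -!(lift_perm_lift p) e//.
Qed.

(* Inserting a new maximum into one of the n+1 gaps of a circular arrangement
   keeps the number of descents if the gap is a descent, and adds one otherwise. *)
Lemma sum_anchored_recursion (V : zmodType) n (f : nat -> V) :
  \sum_(s in anchored n.+1) f (circular_descents s) =
  \sum_(s in anchored n) (f (circular_descents s) *+ circular_descents s +
     f (circular_descents s).+1 *+ (n.+1 - circular_descents s)).
Proof.
rewrite (reindex _ (onW_bij _ (lift_perm_bij ord_max))) big_mkcond /=.
rewrite -(pair_bigA _ (fun s p => if lift_perm p ord_max s \in anchored n.+1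
  then f (circular_descents (lift_perm p ord_max s)) else 0)) /=.
(* With the maximum in position 0 the result is not anchored; that summand is split off here and
   vanishes. *)
rewrite [RHS]big_mkcond; apply: eq_bigr => s _; rewrite big_ord_recl.
rewrite inE lift_perm_id /= add0r [in RHS]inE.
rewrite (eq_bigr (fun q => if s ord0 == ord0 then
    f (circular_descents (lift_perm (lift ord0 q) ord_max s)) else 0)).
  case: ifP => _; last by rewrite big1.
  transitivity (\sum_q if (s (ordS q) < s q)%N then f (circular_descents s)
   else f (circular_descents s).+1).
    apply: eq_bigr => q _; have := circular_descents_insert s q.
    by case: ifP => _; [rewrite addn1 => -[->]|rewrite addn0 => ->].
  rewrite (bigID (fun q => s (ordS q) < s q)%N) /=.
  rewrite (eq_bigr (fun=> f (circular_descents s))) => [|q ->//].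
  rewrite [X in _ + X](eq_bigr (fun=> f (circular_descents s).+1)); last first.
    by move=> q /negbTE ->.
  rewrite !sumr_const; congr (_ *+ _ + _ *+ _); first by rewrite -cardsE.
  rewrite -[X in (X - _)%N]card_ord /circular_descents cardsE.
  by rewrite -(cardC (fun q => s (ordS q) < s q)%N) addKn; apply: eq_card.
(* An insertion after position q leaves the entry in position 0 where it is. *)
move=> q _.
have e : ord0 = lift (lift ord0 q) ord0 :> 'I_n.+2 by apply: val_inj.
have e' : ord0 = lift ord_max ord0 :> 'I_n.+2 by apply: val_inj.
by rewrite inE [X in lift_perm _ _ _ X]e lift_perm_lift [X in _ == X]e'
  (inj_eq lift_inj).
Qed.

Lemma sum_anchored0 (V : zmodType) (f : nat -> V) :
  \sum_(s in anchored 0) f (circular_descents s) = f 0%N.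
Proof.
rewrite (big_pred1 (1%g : 'S_1)) => [|s]; last first.
  rewrite inE [s ord0]ord1 eqxx; apply/esym/eqP/permP => i.
  by rewrite [LHS]ord1 [RHS]ord1.
by rewrite circular_descents_sum big_ord_recl big_ord0 !perm1 [ordS _]ord1 ltnn.
Qed.

(** The step into the entry 0 is a descent and the step out of it is not. Hence the range of l in
    the theorem misses no arrangement. *)
Lemma circular_descents_bound n (s : 'S_n.+2) :
  s \in anchored n.+1 -> (0 < circular_descents s < n.+2)%N.
Proof.
rewrite inE => /eqP s0; apply/andP; split.
  apply/card_gt0P; exists ord_max; rewrite inE.
  have -> : ordS ord_max = ord0 :> 'I_n.+2 by apply: val_inj; rewrite /= modnn.
  rewrite s0 lt0n; apply/eqP => e.
  have : s ord_max = s ord0 by rewrite s0; apply: val_inj.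
  by move=> /perm_inj/(congr1 val).
rewrite -[X in (_ < X)%N]card_ord -cardsT; apply: proper_card.
apply/properP; split; first exact: finset.subsetT.
by exists ord0; rewrite !inE ?s0.
Qed.

(** Trading Eulerian numbers for a sum over arrangements makes the insertion recurrence applicable
    to any weight f. *)
Lemma sum_circular_eulerian (R : pzRingType) n (f : nat -> R) :
  \sum_(1 <= l < n.+2) f l * (circular_eulerian n.+2 l)%:R =
  \sum_(s in anchored n.+1) f (circular_descents s).
Proof.
under eq_bigr => l _ do rewrite circular_eulerianE -sum1_card natr_sum mulr_sumr.
transitivity (\sum_(1 <= l < n.+2) \sum_(s in anchored n.+1)
    if circular_descents s == l then f l else 0).
  apply: eq_bigr => l _; rewrite -big_mkcondr.
  by apply: eq_big => [s|s _]; rewrite ?inE ?mulr1.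
rewrite exchange_big; apply: eq_bigr => s /circular_descents_bound sn.
rewrite (bigD1_seq (circular_descents s)) ?iota_uniq//=; last first.
  by rewrite mem_index_iota.
rewrite eqxx big1 ?addr0// => l /negbTE sl.
by rewrite eq_sym sl.
Qed.

Lemma is_derive_sum_seq (R : numFieldType) (I : Type) (r : seq I) (P : pred I)
    (h : I -> R -> R) (dh : I -> R) (x : R) :
  (forall i, P i -> is_derive x 1 (h i) (dh i)) ->
  is_derive x 1 (fun y => \sum_(i <- r | P i) h i y) (\sum_(i <- r | P i) dh i).
Proof.
move=> hP; elim: r => [|i r IH].
  rewrite big_nil; under eq_fun do rewrite big_nil.
  exact: is_derive_cst.
rewrite big_cons; under eq_fun do rewrite big_cons.
by case: ifP => // /hP ?; exact: is_deriveD.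
Qed.

(** * Derivatives of the cotangent *)

Section Trig.
Variable R : realType.
Implicit Types x y : R.

(** For n >= 1 this is the inner sum of the theorem at exponent n + 1; for n = 0 it is cos y, which
    a sum over 1 <= l < 1 would miss. *)
Definition euler_cos n y : R :=
  \sum_(s in anchored n) cos ((n.+1%:R - 2 * (circular_descents s)%:R) * y).

Definition euler_sin n y : R :=
  \sum_(s in anchored n) (n.+1%:R - 2 * (circular_descents s)%:R) *
     sin ((n.+1%:R - 2 * (circular_descents s)%:R) * y).

Lemma is_derive_euler_cos n y :
  is_derive y 1 (euler_cos n) (- euler_sin n y).
Proof.
rewrite /euler_sin -sumrN; apply: is_derive_sum_seq => s _.
set a := (_ - _).
have H : is_derive y 1 ( *%R a) a.
  have := @is_deriveZ _ _ _ id a y 1 1 _; rewrite /GRing.scale /= mulr1.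
  exact.
rewrite mulrC -mulNr.
exact: is_derive1_comp (is_derive_cos (a * y)) H.
Qed.

(** Let a = n + 1 and b = a - 2d for an arrangement with d descents. Insertion yields d cos((b+1)y)
    + (a-d) cos((b-1)y), which equals a cos y cos(by) + b sin y sin(by). Up to sign, this is the
    numerator of the derivative of [euler_cos n y / sin y ^+ n.+1]. *)
Lemma euler_cosS n y : euler_cos n.+1 y =
  n.+1%:R * cos y * euler_cos n y + sin y * euler_sin n y.
Proof.
rewrite /euler_cos /euler_sin.
rewrite (sum_anchored_recursion _ (fun d => cos ((n.+2%:R - 2 * d%:R) * y))).
rewrite !mulr_sumr -big_split; apply: eq_bigr => s _ /=.
set d := circular_descents s.
have dn : (d <= n.+1)%N.
  by rewrite /d /circular_descents -[X in (_ <= X)%N]card_ord max_card.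
have n2 : n.+2%:R = n.+1%:R + 1 :> R by rewrite -natr1.
have d1 : d.+1%:R = d%:R + 1 :> R by rewrite -natr1.
rewrite -[cos _ *+ d]mulr_natr -[_ *+ (_ - _)]mulr_natr natrB// n2 d1.
clearbody d; clear s dn n2 d1; move: n.+1%:R d%:R => a e.
have -> : (a + 1 - 2 * e) * y = (a - 2 * e) * y + y by ring.
have -> : (a + 1 - 2 * (e + 1)) * y = (a - 2 * e) * y - y by ring.
rewrite cosD cosB; ring.
Qed.

(* (-1)^n / n! times the n-th derivative of pi cot(pi x); euler_cos n and
   cot_deriv n go with the exponent n + 1. *)
Definition cot_deriv n x : R :=
  pi ^+ n.+1 / n`!%:R * (euler_cos n (pi * x) / sin (pi * x) ^+ n.+1).

Lemma is_derive_cot_deriv n x : sin (pi * x) != 0 ->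
  is_derive x 1 (cot_deriv n) (- (n.+1%:R * cot_deriv n.+1 x)).
Proof.
move=> s0.
have Hpi : is_derive x 1 ( *%R (pi : R)) pi.
  have := @is_deriveZ _ _ _ id (pi : R) x 1 1 _; rewrite /GRing.scale /= mulr1.
  exact.
have H1 := is_derive1_comp (f := euler_cos n) (g := *%R pi)
   (is_derive_euler_cos n (pi * x)) Hpi.
have H2 := is_derive1_comp (f := sin) (g := *%R pi) (is_derive_sin (pi * x)) Hpi.
have H3 := is_deriveX n.+1 (is_deriveV (f := fun x => sin (pi * x)) s0 H2).
have H4 := is_deriveZ (pi ^+ n.+1 / n`!%:R : R) (is_deriveM H1 H3).
rewrite (_ : cot_deriv n = (pi ^+ n.+1 / n`!%:R : R) \*:
    ((euler_cos n \o *%R pi) * (fun y => (sin (pi * y))^-1) ^+ n.+1)); last first.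
  by apply/funext => z; rewrite exprfctE /cot_deriv -exprVn.
apply: is_derive_eq H4 _.
rewrite exprfctE /cot_deriv euler_cosS /GRing.scale /= factS natrM.
have f0 : n`!%:R != 0 :> R by rewrite pnatr_eq0 -lt0n fact_gt0.
have n0 : n.+1%:R != 0 :> R by rewrite pnatr_eq0.
move: s0 f0 n0; rewrite !exprVn !exprS.
move: (n`!%:R) (n.+1%:R) (sin _) (cos _) (euler_sin _ _) (euler_cos _ _).
move=> F m S C ES EC S0 F0 m0; field.
by rewrite expf_neq0// S0 F0.
Qed.

Lemma cot_deriv0 x : cot_deriv 0 x = pi * cot (pi * x).
Proof.
rewrite /cot_deriv /euler_cos /cot !expr1 fact0 divr1.
by rewrite (sum_anchored0 (fun d => cos ((1 - 2 * d%:R) * _))) mulr0 subr0 mul1r.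
Qed.

(** Two entries have a single circular arrangement, with one descent, so the numerator is cos 0. *)
Lemma cot_deriv1 x : cot_deriv 1 x = (pi / sin (pi * x)) ^+ 2.
Proof.
rewrite /cot_deriv /euler_cos.
rewrite (sum_anchored_recursion _ (fun d => cos ((2 - 2 * d%:R) * (pi * x)))).
rewrite (sum_anchored0 (fun d => cos ((2 - 2 * d%:R) * (pi * x)) *+ d +
  cos ((2 - 2 * d.+1%:R) * (pi * x)) *+ (1 - d))).
by rewrite mulr0n add0r mulr1 subrr mul0r cos0 divr1 mulr1n mul1r exprMn exprVn.
Qed.

End Trig.

(** * Lattice sums *)

Section LatticeSeries.
Local Open Scope classical_set_scope.
Variable R : realType.
Implicit Types (x h c : R) (n j K : nat).

Lemma sum_inv_sqr_le2 K : \sum_(0 <= j < K) j.+1%:R^-1 ^+ 2 <= 2 :> R.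
Proof.
(* Telescoping, by 1/(k+1)^2 <= 1/k - 1/(k+1). At K = 0 the default value 0 of the inverse makes the
   bound 2. *)
suff: \sum_(0 <= j < K) j.+1%:R^-1 ^+ 2 <= 2 - K%:R^-1 :> R.
  by move=> /le_trans; apply; rewrite gerBl invr_ge0.
elim: K => [|[|K] IH]; first by rewrite big_nil invr0 subr0.
  by rewrite big_nat1 invr1 expr1n; lra.
rewrite big_nat_recr//= (le_trans (lerD IH (lexx _)))//.
rewrite -[K.+2%:R]natr1; set k : R := K.+1%:R.
have k0 : 0 < k by rewrite ltr0n.
have k1 : 0 < k + 1 by lra.
have E : k^-1 = (k + 1)^-1 + (k * (k + 1))^-1 by field; rewrite !gt_eqF.
have : (k + 1)^-1 ^+ 2 <= (k * (k + 1))^-1.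
  by rewrite expr2 -invfM lef_pV2 ?posrE ?mulr_gt0// ler_pM2r//; lra.
by rewrite E; move: ((k + 1)^-1 ^+ 2) (k * _)^-1 (k + 1)^-1 => *; lra.
Qed.

Lemma cvg_series_inv_sqr : cvgn (series (fun j => j.+1%:R^-1 ^+ 2 : R)).
Proof.
apply: nondecreasing_is_cvgn.
  by apply: nondecreasing_series => j _ _; exact: sqr_ge0.
by exists 2 => _ [K _ <-]; exact: sum_inv_sqr_le2.
Qed.

(* The terms k = j and k = -j-1 of \sum_k (x + k)^-n over all integers k; paired
   in this way the series converges absolutely also for n = 1. *)
Definition lattice_term n x j : R :=
  (x + j%:R)^-1 ^+ n + (x - j.+1%:R)^-1 ^+ n.

Definition lattice_sum n x : R := limn (series (lattice_term n x)).

(** The distance c to the poles 0 and 1 makes the estimates below uniform in x. *)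
Definition far c x := (0 < c) && (c <= x <= 1 - c).

Lemma far_neq0 c x j : far c x -> x + j%:R != 0 /\ x - j.+1%:R != 0.
Proof.
move=> /and3P[c0 cx xc]; have j0 : 0 <= j%:R :> R by [].
by split; [rewrite gt_eqF|rewrite lt_eqF -?natr1]; lra.
Qed.

(** Both denominators have modulus at least c + j, and c + j >= c (j + 1) because c <= 1. *)
Lemma lattice_inv_bound c x j : far c x ->
  `|(x + j%:R)^-1| <= c^-1 * j.+1%:R^-1 /\
  `|(x - j.+1%:R)^-1| <= c^-1 * j.+1%:R^-1.
Proof.
move=> fx; have [n1 n2] := far_neq0 j fx; move: fx => /and3P[c0 cx xc].
have j0 : 0 <= j%:R :> R by [].
have c1 : c * j%:R <= j%:R by rewrite ler_piMl//; lra.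
rewrite !normfV -invfM; split; rewrite lef_pV2 ?posrE ?mulr_gt0 ?normr_gt0//.
  by rewrite ger0_norm -?natr1; lra.
by rewrite ler0_norm -?natr1; lra.
Qed.

Lemma lattice_pow_bound c j n (u : R) : 0 < c ->
  `|u| <= c^-1 * j.+1%:R^-1 ->
  `|u ^+ n.+2| <= c^-1 ^+ n.+2 * j.+1%:R^-1 ^+ 2.
Proof.
move=> c0 uw; rewrite normrX.
have ic0 : 0 <= c^-1 by rewrite invr_ge0 ltW.
apply: (@le_trans _ _ ((c^-1 * j.+1%:R^-1) ^+ n.+2)).
  by apply: lerXn2r; rewrite ?nnegrE//= mulr_ge0.
rewrite exprMn; apply: ler_wpM2l; first exact: exprn_ge0.
rewrite -(addn2 n) exprD ler_piMl ?sqr_ge0//.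
by rewrite exprn_ile1 ?invr_ge0// invf_le1// ler1n.
Qed.

(** For exponent 1 the pairing is essential: the two fractions add up to 2x - 1 times their product,
    and |2x - 1| <= 1. For larger exponents each fraction is bounded separately. *)
Lemma lattice_term_bound c x n : far c x ->
  exists C : R, forall j, `|lattice_term n.+1 x j| <= C * j.+1%:R^-1 ^+ 2.
Proof.
move=> fx; have c0 : 0 < c by case/andP: fx.
have ic0 : 0 <= c^-1 by rewrite invr_ge0 ltW.
case: n => [|n].
  exists (c^-1 ^+ 2) => j; rewrite /lattice_term !expr1.
  have [n1 n2] := far_neq0 j fx; have [b1 b2] := lattice_inv_bound j fx.
  have -> : (x + j%:R)^-1 + (x - j.+1%:R)^-1 =
      (2 * x - 1) * ((x + j%:R)^-1 * (x - j.+1%:R)^-1).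
    rewrite -natr1 in n2 *.
    by field; rewrite n1 n2.
  rewrite normrM -exprMn expr2 normrM.
  apply: (@le_trans _ _ (1 * ((c^-1 * j.+1%:R^-1) * (c^-1 * j.+1%:R^-1)))).
    by rewrite !ler_pM ?mulr_ge0// ler_norml; case/and3P: fx => *; lra.
  by rewrite mul1r.
exists (c^-1 ^+ n.+2 *+ 2) => j; have [b1 b2] := lattice_inv_bound j fx.
rewrite /lattice_term mulrnAl mulr2n (le_trans (ler_normD _ _))// lerD//.
  exact: lattice_pow_bound.
exact: lattice_pow_bound.
Qed.

Lemma cvg_lattice_series c x n : far c x ->
  series (lattice_term n.+1 x) @ \oo --> lattice_sum n.+1 x.
Proof.
move=> /(lattice_term_bound n)[C HC]; apply: normed_cvg.
apply: (@series_le_cvg _ _ (C *: (fun j => j.+1%:R^-1 ^+ 2 : R))) => //.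
  - by move=> j; exact: normr_ge0.
  - by move=> j; exact: le_trans (normr_ge0 _) (HC j).
rewrite seriesZ; apply: is_cvgZr; exact: cvg_series_inv_sqr.
Qed.

(** Second-order Taylor remainder of a^-n, by induction on n from u - v = h u v. The bound depends
    on a only through w. *)
Lemma inv_pow_remainder (a h w : R) n : a != 0 -> a + h != 0 ->
  `|a^-1| <= w -> `|(a + h)^-1| <= w ->
  `|(a + h)^-1 ^+ n - a^-1 ^+ n + n%:R * h * a^-1 ^+ n.+1| <=
    n%:R ^+ 2 * h ^+ 2 * w ^+ n.+2.
Proof.
move=> a0 b0; set u := a^-1; set v := (a + h)^-1 => uw vw.
have w0 : 0 <= w by exact: le_trans uw.
have uv : u - v = h * u * v by rewrite /u /v; field; rewrite a0 b0.
elim: n => [|n IH]; first by rewrite !expr0 !mul0r subrr addr0 normr0 expr0n !mul0r.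
have -> : v ^+ n.+1 - u ^+ n.+1 + n.+1%:R * h * u ^+ n.+2 =
    v * (v ^+ n - u ^+ n + n%:R * h * u ^+ n.+1) +
    n.+1%:R * (h ^+ 2 * u ^+ n.+2 * v).
  apply/eqP; rewrite -subr_eq0; apply/eqP.
  transitivity ((n.+1%:R * h * u ^+ n.+1 - u ^+ n) * (u - v - h * u * v)).
    by rewrite -natr1 !exprS; ring.
  by rewrite uv subrr mulr0.
apply: le_trans (ler_normD _ _) _.
have bu : `|u ^+ n.+2 * v| <= w ^+ n.+3.
  by rewrite normrM normrX [_ ^+ n.+3]exprSr ler_pM// lerXn2r ?nnegrE.
apply: (@le_trans _ _ (w * (n%:R ^+ 2 * h ^+ 2 * w ^+ n.+2) +
   n.+1%:R * (h ^+ 2 * w ^+ n.+3))).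
  apply: lerD; first by rewrite normrM ler_pM.
  rewrite normrM ger0_norm// ler_wpM2l// -mulrA normrM ger0_norm ?sqr_ge0//.
  by rewrite ler_wpM2l ?sqr_ge0.
rewrite -subr_ge0 -natr1 [w ^+ n.+3]exprS.
set W := w ^+ _; set m : R := n%:R.
(* The constant n^2 is not sharp, but it survives the induction: (m+1)^2 - m^2 - (m+1) = m >= 0. *)
have -> : (m + 1) ^+ 2 * h ^+ 2 * (w * W) - (w * (m ^+ 2 * h ^+ 2 * W) +
   (m + 1) * (h ^+ 2 * (w * W))) = m * (h ^+ 2 * (w * W)) by ring.
have W0 : 0 <= W by exact: exprn_ge0.
by apply: mulr_ge0 => //; apply: mulr_ge0; [exact: sqr_ge0|exact: mulr_ge0].
Qed.

(** A quadratic error bound passes to limits of partial sums, which replaces a theorem on termwise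
    differentiation. *)
Lemma is_derive_quadratic_bound (f : R -> R) x l c C : 0 < c ->
  (forall h, `|h| <= c -> `|f (x + h) - f x - h * l| <= C * h ^+ 2) ->
  is_derive x 1 f l.
Proof.
move=> c0 H.
have C0 : 0 <= C.
  have := H c; rewrite ger0_norm ?(ltW c0)// lexx => /(_ isT)/(le_trans _)-/(_ _ (normr_ge0 _)).
  by rewrite pmulr_lge0// exprn_gt0.
have L : h^-1 *: ((f \o shift x) (h *: (1 : R)) - f x) @[h --> 0^'] --> l.
  apply/cvgrPdist_le => e e0; near=> h.
  have h0 : h != 0 by near: h; exact: nbhs_dnbhs_neq.
  have hc : `|h| <= c.
    near: h; apply: nbhs_dnbhs; apply/nbhs_normP; exists c => //= h.
    by rewrite /ball_ /= sub0r normrN => /ltW.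
  (* The denominator C + 1 stays positive when C = 0. *)
  have he : `|h| <= e / (C + 1).
    near: h; apply: nbhs_dnbhs; apply/nbhs_normP.
    exists (e / (C + 1)) => /=; first by rewrite divr_gt0// ltr_wpDl.
    by move=> h; rewrite /ball_ /= sub0r normrN => /ltW.
  have -> : l - h^-1 *: ((f \o shift x) (h *: (1 : R)) - f x) =
      - h^-1 * (f (x + h) - f x - h * l).
    rewrite /= /GRing.scale /= mulr1 (addrC h).
    by field.
  rewrite normrM normrN normfV ler_pdivrMl ?normr_gt0//.
  rewrite (le_trans (H _ hc))// -real_normK ?num_real// expr2 mulrCA.
  rewrite ler_wpM2l// (le_trans (ler_wpM2l C0 he))// mulrCA ler_piMr ?(ltW e0)//.
  by rewrite ler_pdivrMr ?mul1r ?lerDl// ltr_wpDl.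
split; first by apply/cvg_ex; exists l.
exact/cvg_lim.
Unshelve. all: by end_near. Qed.

End LatticeSeries.

(** * Termwise differentiation of lattice sums, and bounds for the sine *)

Section LatticeDerivative.
Local Open Scope classical_set_scope.
Variable R : realType.
Implicit Types (x y h c : R) (n j K : nat).

(** With c half the distance from x to {0, 1}, a shift by at most c still leaves distance c. *)
Lemma far_nbhs x : 0 < x < 1 ->
  exists2 c, 0 < c & forall h, `|h| <= c -> far c (x + h).
Proof.
move=> /andP[x0 x1]; exists (Num.min x (1 - x) / 2).
  by rewrite divr_gt0// lt_min x0 subr_gt0.
set m := Num.min _ _ => h; rewrite ler_norml => /andP[h1 h2].
have m0 : 0 < m by rewrite lt_min x0 subr_gt0.
have mx : m <= x by rewrite /m ge_min lexx.
have mx' : m <= 1 - x by rewrite /m ge_min lexx orbT.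
by apply/and3P; split; lra.
Qed.

Lemma far_in01 x : 0 < x < 1 -> exists c, far c x.
Proof.
move=> /far_nbhs[c c0 /(_ 0)]; rewrite normr0 addr0 => H.
by exists c; apply: H; exact: ltW.
Qed.

Lemma cvg_lattice_sum x n : 0 < x < 1 ->
  series (lattice_term n.+1 x) @ \oo --> lattice_sum n.+1 x.
Proof. by move=> /far_in01[c]; exact: cvg_lattice_series. Qed.

(** Every partial sum satisfies the quadratic estimate with a constant independent of K, and so does
    the limit. *)
Lemma is_derive_lattice_sum n x : 0 < x < 1 ->
  is_derive x 1 (lattice_sum n.+1) (- (n.+1%:R * lattice_sum n.+2 x)).
Proof.
move=> x01; have [c c0 fc] := far_nbhs x01.
have fx : far c x by rewrite -[x]addr0; apply: fc; rewrite normr0 ltW.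
(* Each pair contributes two remainders, hence the factor 2 in [D]; the 2 in [D * 2] below bounds
   the sum of the (j+1)^-2. *)
pose D : R := n.+1%:R ^+ 2 * c^-1 ^+ n.+3 *+ 2.
have D0 : 0 <= D.
  by rewrite mulrn_wge0// mulr_ge0 ?sqr_ge0// exprn_ge0// invr_ge0 ltW.
apply: (@is_derive_quadratic_bound _ _ _ _ c (D * 2)) => // h hc.
have fxh := fc h hc.
have L : `|series (lattice_term n.+1 (x + h)) K - series (lattice_term n.+1 x) K -
    h * (- (n.+1%:R * series (lattice_term n.+2 x) K))| @[K --> \oo] -->
    `|lattice_sum n.+1 (x + h) - lattice_sum n.+1 x -
    h * (- (n.+1%:R * lattice_sum n.+2 x))|.
  apply: cvg_norm; apply: cvgB; first by apply: cvgB;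
    [exact: cvg_lattice_series fxh|exact: cvg_lattice_series fx].
  by apply: cvgM; [exact: cvg_cst|apply: cvgN; apply: cvgM;
    [exact: cvg_cst|exact: cvg_lattice_series fx]].
rewrite -(cvg_lim _ L)//; apply: limr_le; first exact: cvgP L.
apply: nearW => K; rewrite mulrN opprK /series /= !mulr_sumr -sumrB -big_split /=.
apply: le_trans (ler_norm_sum _ _ _) _.
have B j : `|lattice_term n.+1 (x + h) j - lattice_term n.+1 x j +
    h * (n.+1%:R * lattice_term n.+2 x j)| <= D * h ^+ 2 * j.+1%:R^-1 ^+ 2.
  have [n1 n2] := far_neq0 j fx; have [b1 b2] := lattice_inv_bound j fx.
  have [m1 m2] := far_neq0 j fxh; have [d1 d2] := lattice_inv_bound j fxh.
  rewrite addrAC in m1 d1; rewrite addrAC in m2 d2.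
  have r1 := inv_pow_remainder n.+1 n1 m1 b1 d1.
  have r2 := inv_pow_remainder n.+1 n2 m2 b2 d2.
  have W : (c^-1 * j.+1%:R^-1) ^+ n.+3 <= c^-1 ^+ n.+3 * j.+1%:R^-1 ^+ 2.
    have w0 : 0 <= c^-1 * j.+1%:R^-1 by rewrite mulr_ge0// invr_ge0 ltW.
    have := @lattice_pow_bound _ c j n.+1 (c^-1 * j.+1%:R^-1) c0.
    by rewrite !ger0_norm ?exprn_ge0//; apply.
  have W' : n.+1%:R ^+ 2 * h ^+ 2 * (c^-1 * j.+1%:R^-1) ^+ n.+3 <=
      n.+1%:R ^+ 2 * h ^+ 2 * (c^-1 ^+ n.+3 * j.+1%:R^-1 ^+ 2).
    by apply: ler_wpM2l W; apply: mulr_ge0; exact: sqr_ge0.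
  have -> : D * h ^+ 2 * j.+1%:R^-1 ^+ 2 =
      n.+1%:R ^+ 2 * h ^+ 2 * (c^-1 ^+ n.+3 * j.+1%:R^-1 ^+ 2) +
      n.+1%:R ^+ 2 * h ^+ 2 * (c^-1 ^+ n.+3 * j.+1%:R^-1 ^+ 2).
    by rewrite /D mulr2n; ring.
  apply: le_trans (lerD (le_trans r1 W') (le_trans r2 W')).
  apply: le_trans (ler_normD _ _).
  rewrite /lattice_term (addrAC x h) (addrAC x h) le_eqVlt; apply/orP; left.
  by apply/eqP; congr (`|_|); ring.
apply: le_trans (ler_sum _ (fun j _ => B j)) _; rewrite -mulr_sumr [leRHS]mulrAC.
apply: ler_wpM2l; first by apply: mulr_ge0; last exact: sqr_ge0.
exact: sum_inv_sqr_le2.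
Qed.

Lemma sin_le_id y : 0 <= y -> sin y <= y.
Proof.
move=> y0; have [|z _] := @MVT_segment R sin cos 0 y y0.
  by apply: continuous_subspaceT; exact: continuous_sin.
by rewrite sin0 !subr0 => ->; rewrite ler_piMl// cos_le1.
Qed.

Lemma mul_cos_le_sin y : 0 <= y <= pi -> y * cos y <= sin y.
Proof.
move=> /andP[y0 ypi]; rewrite -subr_ge0.
have H (z : R) : is_derive z 1 (fun z => sin z - z * cos z) (z * sin z).
  have := is_deriveB (is_derive_sin z) (is_deriveM (is_derive_id z 1) (is_derive_cos z)).
  by move=> /is_derive_eq; apply; rewrite /GRing.scale /=; ring.
have [|z zy] := @MVT_segment R _ (fun z => z * sin z) 0 y y0.
  apply: continuous_subspaceT => z.
  by apply: differentiable_continuous; apply/derivable1_diffP; case: (H z).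
rewrite sin0 mul0r !subr0 => ->; move: zy; rewrite in_itv/= => /andP[z0 zy].
by rewrite !mulr_ge0// sin_ge0_pi// z0 (le_trans zy).
Qed.

(** For 0 < y <= pi/2, y cos y <= sin y <= y. Squaring the left inequality gives y^2 (1 - sin^2 y)
    <= sin^2 y, and dividing by y^2 sin^2 y gives the upper bound. *)
Lemma inv_sin_sqr_bounds y : y != 0 -> `|y| <= pi / 2 ->
  y^-1 ^+ 2 <= (sin y)^-1 ^+ 2 <= y^-1 ^+ 2 + 1.
Proof.
move=> y0; wlog y0' : y y0 / 0 < y.
  move=> H; have [|yn] := ltP 0 y; first exact: H.
  have := H (- y); rewrite oppr_eq0 y0 oppr_gt0 lt_neqAle y0 yn normrN sinN !invrN !sqrrN.
  by apply.
rewrite gtr0_norm// => ypi.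
have p0 : 0 < pi :> R by exact: pi_gt0.
have s0 : 0 < sin y by apply: sin_gt0_pi; rewrite y0'/=; lra.
have c0 : 0 <= cos y by apply: cos_ge0_pihalf; lra.
have sy := sin_le_id (ltW y0').
have /mul_cos_le_sin cs : 0 <= y <= pi by lra.
apply/andP; split.
  by apply: lerXn2r; rewrite ?nnegrE ?invr_ge0 ?(ltW s0) ?(ltW y0')// lef_pV2 ?posrE.
have : (y * cos y) ^+ 2 <= sin y ^+ 2.
  by apply: lerXn2r; rewrite ?nnegrE ?mulr_ge0 ?(ltW s0) ?(ltW y0').
rewrite exprMn cos2sin2 => H.
rewrite !exprVn -lerBlDr -(ler_pM2r (exprn_gt0 2 s0)) mulrBl mulVf ?gt_eqF ?exprn_gt0// mul1r.
by rewrite mulrC ler_pdivlMr ?exprn_gt0// mulrC.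
Qed.

End LatticeDerivative.

(** Used when the number of points doubles, to fold the new upper half of the pairs onto the lower
    half. *)
Lemma sum_nat_fold (V : nmodType) (f : nat -> V) a :
  \sum_(0 <= j < a + a) f j = \sum_(0 <= j < a) (f j + f (a + a - j.+1)%N).
Proof.
rewrite big_split (@big_cat_nat _ _ _ a) ?leq_addr//=.
congr (_ + _); rewrite [RHS]big_nat_rev -{1}[a]add0n big_addn addnK; apply: eq_big_nat => j ja.
by congr f; lia.
Qed.

(** * Partial fractions of the cotangent and its derivatives *)

Section CotangentExpansion.
Local Open Scope classical_set_scope.
Variable R : realType.
Implicit Types (x y h c : R) (n j K J : nat).

Lemma sin_neq0_pihalf y : y != 0 -> `|y| <= pi / 2 -> sin y != 0.
Proof.
(* If sin y were 0, its inverse would be 0 by default, below the positive lower bound y^-2. *)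
move=> y0 /(inv_sin_sqr_bounds y0)/andP[+ _]; apply: contraTneq => ->.
by rewrite invr0 expr0n -ltNge exprn_even_gt0 ?invr_eq0.
Qed.

Lemma inv_sin_sqr_dup y : sin (2 * y) != 0 ->
  4 * (sin (2 * y))^-1 ^+ 2 =
  (sin y)^-1 ^+ 2 + (cos y)^-1 ^+ 2.
Proof.
rewrite mulr2n mulrDl mul1r -mulr2n sin_mulr2n -mulr_natr.
rewrite !mulf_eq0 !negb_or => /andP[/andP[c0 s0] _].
have -> : (sin y)^-1 ^+ 2 + (cos y)^-1 ^+ 2 =
    (cos y ^+ 2 + sin y ^+ 2) / (sin y ^+ 2 * cos y ^+ 2).
  by field; rewrite c0 s0.
by rewrite cos2Dsin2; field; rewrite c0 s0.
Qed.

(** Finite analogue of [lattice_term 2], with the same pairing of k = j and k = -j-1. *)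
Definition csc_pair (m x : R) j : R :=
  (sin (pi * (x + j%:R) / m))^-1 ^+ 2 + (sin (pi * (x - j.+1%:R) / m))^-1 ^+ 2.

(** The arguments stay in the range where 1 / sin(y)^2 can be compared with 1 / y^2. *)
Lemma csc_pair_arg x j (m : R) : 0 < x < 1 -> j.+1%:R <= m ->
  [/\ pi * (x + j%:R) / (2 * m) != 0, pi * (x - j.+1%:R) / (2 * m) != 0,
    `|pi * (x + j%:R) / (2 * m)| <= pi / 2 &
    `|pi * (x - j.+1%:R) / (2 * m)| <= pi / 2].
Proof.
move=> x01 jm; have p0 : 0 < pi :> R by exact: pi_gt0.
have j0 : 0 <= j%:R :> R by [].
have m0 : 0 < 2 * m by rewrite -natr1 in jm; lra.
have [|n1 n2] := @far_neq0 R (Num.min x (1 - x)) x j.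
  by apply/and3P; rewrite lt_min ge_min lexx lerBrDr -lerBrDl ge_min lexx orbT; split => //; lra.
have P z : `|z| <= m -> `|pi * z / (2 * m)| <= pi / 2.
  move=> zm; rewrite !normrM normfV (gtr0_norm p0) (gtr0_norm m0).
  rewrite -mulrA ler_wpM2l ?(ltW p0)// ler_pdivrMr//.
  by rewrite mulrA mulVf ?mul1r// pnatr_eq0.
split; rewrite ?mulf_neq0 ?invr_eq0 ?(gt_eqF p0) ?(gt_eqF m0)//.
  by apply: P; rewrite ger0_norm -?natr1 in jm *; lra.
by apply: P; rewrite ler0_norm -?natr1 in jm *; lra.
Qed.

(** The duplication formula replaces each point y = pi (x + k) / 2^(J+1), -2^J <= k < 2^J, by y/2
    and y/2 - pi/2 or y/2 + pi/2. The sign is chosen so that the new k fill the next symmetric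
    range. *)
Lemma csc_sqr_pow2 x J : 0 < x < 1 ->
  4 ^+ J.+1 * (sin (pi * x))^-1 ^+ 2 =
  \sum_(0 <= j < 2 ^ J) csc_pair (2 * 2 ^+ J) x j.
Proof.
move=> x01; elim: J => [|J IH].
  have p0 : 0 < pi :> R by exact: pi_gt0.
  have -> : pi * x = 2 * (pi * x / 2) by field.
  rewrite expn0 big_nat1 /csc_pair expr0 mulr1 addr0 inv_sin_sqr_dup; last first.
    have -> : 2 * (pi * x / 2) = pi * x by field.
    rewrite gt_eqF// sin_gt0_pi// mulr_gt0//; last by lra.
    by rewrite -[X in _ < X]mulr1 ltr_pM2l//; lra.
  have -> : pi * (x - 1) / 2 = pi * x / 2 - pi / 2 by field.
  by rewrite sinBpihalf invrN sqrrN.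
rewrite exprS -mulrA IH mulr_sumr expnS mul2n -addnn sum_nat_fold.
apply: eq_big_nat => j /andP[_ jJ].
set m : R := 2 ^+ J.
have m0 : m != 0 by rewrite expf_neq0.
have jm : j.+1%:R <= m by rewrite /m -natrX ler_nat.
have [a0 b0 a1 b1] := csc_pair_arg x01 jm.
have sa := sin_neq0_pihalf a0 a1; have sb := sin_neq0_pihalf b0 b1.
rewrite /csc_pair [2 ^+ J.+1]exprS -/m mulrDr.
set a := pi * (x + _) / (2 * m) in a0 a1 sa *.
set b := pi * (x - _) / (2 * m) in b0 b1 sb *.
have a2 : pi * (x + j%:R) / (2 * (2 * m)) = a / 2 by rewrite /a; field.
have b2 : pi * (x - j.+1%:R) / (2 * (2 * m)) = b / 2.
  by rewrite /b; field.
(* The companion of a/2 is the second member of the pair 2^(J+1) - j - 1, and the companion of b/2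
   is its first. *)
have a3 : pi * (x - (2 ^ J + 2 ^ J - j.+1).+1%:R) / (2 * (2 * m)) = a / 2 - pi / 2.
  rewrite subnSK; last by lia.
  rewrite natrB ?natrD ?natrX -/m; last by lia.
  by rewrite /a; field.
have b3 : pi * (x + (2 ^ J + 2 ^ J - j.+1)%:R) / (2 * (2 * m)) = b / 2 + pi / 2.
  rewrite natrB ?natrD ?natrX -/m; last by lia.
  by rewrite /b; field.
rewrite a2 a3 b2 b3 sinBpihalf sinDpihalf invrN sqrrN.
have a4 : a = 2 * (a / 2) by field.
have b4 : b = 2 * (b / 2) by field.
rewrite a4 b4 in sa sb; rewrite {1}a4 {1}b4 !inv_sin_sqr_dup//; ring.
Qed.

(** Each of the 2^(J+1) points costs an error between 0 and 1 in the comparison. After scaling by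
    pi^2 / 4^(J+1) the total error is at most pi^2 / 2^(J+1), hence below the geometric term, and a
    squeeze concludes. *)
Lemma lattice_sum2 x : 0 < x < 1 -> lattice_sum 2 x = (pi / sin (pi * x)) ^+ 2.
Proof.
move=> x01; have p0 : 0 < pi :> R by exact: pi_gt0.
set s := (_ ^+ 2).
pose u J := series (lattice_term 2 x) (2 ^ J)%N.
have uF : u @ \oo --> lattice_sum 2 x.
  have p2 : (fun J => 2 ^ J)%N @ \oo --> \oo.
    move=> P [K _ HP]; exists K => // k /= Kk.
    by apply: HP => /=; apply: leq_trans Kk _; rewrite ltnW// ltn_expl.
  by apply: (@cvg_comp _ _ _ (fun J => 2 ^ J)%N (series (lattice_term 2 x)) _ _ _ p2); exact: cvg_lattice_sum.
have us J : u J <= s <= u J + geometric (pi ^+ 2) 2^-1 J.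
  set m : R := 2 ^+ J; have m0 : 0 < m by rewrite exprn_gt0.
  have m0' : m != 0 by rewrite gt_eqF.
  have p0' : pi != 0 :> R by rewrite gt_eqF.
  have -> : s = pi ^+ 2 / (2 * m) ^+ 2 * (4 ^+ J.+1 * (sin (pi * x))^-1 ^+ 2).
    have -> : 4 ^+ J.+1 = (2 * m) ^+ 2.
      by rewrite /m -exprS -exprM mulnC exprM; congr (_ ^+ _); ring.
    rewrite mulrA mulfVK ?expf_neq0 ?mulf_neq0//.
    by rewrite /s exprMn.
  rewrite csc_sqr_pow2//.
  have T j : (0 <= j < 2 ^ J)%N ->
     (2 * m) ^+ 2 / pi ^+ 2 * lattice_term 2 x j <= csc_pair (2 * m) x j <=
     (2 * m) ^+ 2 / pi ^+ 2 * lattice_term 2 x j + 2.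
    move=> /andP[_ jJ]; have jm : j.+1%:R <= m by rewrite /m -natrX ler_nat.
    have [a0 b0 a1 b1] := csc_pair_arg x01 jm.
    have E z : (2 * m) ^+ 2 / pi ^+ 2 * z^-1 ^+ 2 = (pi * z / (2 * m))^-1 ^+ 2.
      by rewrite invf_div [RHS]exprMn [(pi * z)^-1]invfM [(pi^-1 * _) ^+ 2]exprMn [pi^-1 ^+ 2]exprVn mulrA.
    rewrite /lattice_term mulrDr !E /csc_pair.
    have := inv_sin_sqr_bounds a0 a1; have := inv_sin_sqr_bounds b0 b1.
    by move: ((pi * _ / _)^-1 ^+ 2) ((pi * _ / _)^-1 ^+ 2) ((sin _)^-1 ^+ 2)
      ((sin _)^-1 ^+ 2) => a b c d; lra.
  have T1 : (2 * m) ^+ 2 / pi ^+ 2 * u J <= \sum_(0 <= j < 2 ^ J) csc_pair (2 * m) x j.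
    by rewrite /u /series /= mulr_sumr; apply: ler_sum_nat => j /T /andP[].
  have T2 : \sum_(0 <= j < 2 ^ J) csc_pair (2 * m) x j <=
     (2 * m) ^+ 2 / pi ^+ 2 * u J + 2 * m.
    have E2 : 2 * m = \sum_(0 <= j < 2 ^ J) 2.
      by rewrite sumr_const_nat subn0 -[RHS]mulr_natr natrX.
    rewrite [X in _ <= _ + X]E2 /u /series /= mulr_sumr -big_split.
    by apply: ler_sum_nat => j /T /andP[].
  have K0 : 0 < (2 * m) ^+ 2 / pi ^+ 2 by rewrite divr_gt0 ?exprn_gt0 ?mulr_gt0.
  have E : pi ^+ 2 / (2 * m) ^+ 2 = ((2 * m) ^+ 2 / pi ^+ 2)^-1 by rewrite invf_div.
  rewrite E; apply/andP; split; first by rewrite mulrC ler_pdivlMr// mulrC.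
  rewrite mulrC ler_pdivrMr// (le_trans T2)// [leRHS]mulrDl mulrC lerD2l.
  rewrite /geometric /= exprVn -/m.
  have -> : pi ^+ 2 / m * ((2 * m) ^+ 2 / pi ^+ 2) = 4 * m.
    by move: pi p0' => P P0; field; rewrite P0 m0'.
  by lra.
have G0 : geometric (pi ^+ 2 : R) 2^-1 @ \oo --> 0.
  by apply: cvg_geometric; rewrite ger0_norm ?invr_ge0// invf_lt1// ltr1n.
have : u @ \oo --> s.
  apply: (@squeeze_cvgr _ _ _ _ (fun J => s - geometric (pi ^+ 2) 2^-1 J) (fun=> s)).
  - apply: nearW => J; have /andP[-> H] := us J; rewrite andbT.
    by rewrite lerBlDr.
  - rewrite -[X in _ --> X]subr0; apply: cvgB => //; exact: cvg_cst.
  - exact: cvg_cst.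
by move=> us'; rewrite -(cvg_lim _ uF)// (cvg_lim _ us').
Qed.

Lemma sin_pi_mul_neq0 x : 0 < x < 1 -> sin (pi * x) != 0.
Proof.
move=> /andP[x0 x1]; rewrite gt_eqF// sin_gt0_pi//.
by rewrite mulr_gt0 ?pi_gt0//= -[X in _ < X]mulr1 ltr_pM2l ?pi_gt0.
Qed.

Lemma lattice_sum1 x : 0 < x < 1 -> lattice_sum 1 x = cot_deriv 0 x.
Proof.
move=> x01.
pose D (z : R) := lattice_sum 1 z - cot_deriv 0 z.
have dD (z : R) : 0 < z < 1 -> is_derive z 1 D 0.
  move=> z01; have := is_deriveB (is_derive_lattice_sum 0 z01)
    (is_derive_cot_deriv 0 (sin_pi_mul_neq0 z01)).
  by rewrite lattice_sum2// cot_deriv1 subrr.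
(* At 1/2 the two terms of every pair cancel, and so does cot(pi/2). *)
have D0 : D 2^-1 = 0.
  rewrite /D cot_deriv0 /cot cos_pihalf mul0r mulr0 subr0.
  have -> : lattice_sum 1 (2^-1 : R) = limn (fun=> 0 : R).
    congr (limn _); apply/funext => K; rewrite /series /= big1// => j _.
    rewrite /lattice_term !expr1 -[j.+1%:R]natr1.
    have -> : 2^-1 - (j%:R + 1) = - (2^-1 + j%:R) :> R by field.
    by rewrite invrN subrr.
  exact: lim_cst.
have C a b : 0 < a -> b < 1 -> {within `[a, b], continuous D}.
  move=> a0 b1; apply: continuous_in_subspaceT => z.
  rewrite inE/= in_itv/= => /andP[az zb].
  have /dD dz : 0 < z < 1 by rewrite (lt_le_trans a0 az) (le_lt_trans zb b1).
  by apply: differentiable_continuous; apply/derivable1_diffP; case: dz.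
have E a b : 0 < a -> b < 1 -> a <= b -> D a = D b.
  move=> a0 b1 ab; have [||c _] := @MVT_segment R D (fun=> 0) a b ab.
  - move=> z; rewrite in_itv/= => /andP[az zb]; apply: dD.
    by rewrite (lt_trans a0 az) (lt_trans zb b1).
  - exact: C.
  by rewrite mul0r => /eqP; rewrite subr_eq0 => /eqP ->.
suff : D x = 0 by move=> /eqP; rewrite subr_eq0 => /eqP.
move: x01 => /andP[x0 x1]; rewrite -D0.
by have [xh|hx] := leP x 2^-1; [|apply/esym]; apply: E => //; rewrite ?(ltW hx)// ?invf_lt1 ?invr_gt0 ?ltr1n.
Qed.

Lemma lattice_sumE n x : 0 < x < 1 -> lattice_sum n.+1 x = cot_deriv n x.
Proof.
elim: n x => [|n IH] x x01; first exact: lattice_sum1.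
have d1 := is_derive_lattice_sum n x01.
have d2 := is_derive_cot_deriv n (sin_pi_mul_neq0 x01).
(* The induction hypothesis holds on a neighbourhood of x, so both sides have the same derivative
   there; n + 1 then cancels. *)
have : is_derive x 1 (lattice_sum n.+1) (- (n.+1%:R * cot_deriv n.+1 x)).
  apply: near_eq_is_derive d2.
  have [c c0 cx] := far_nbhs x01.
  apply/nbhs_normP; exists c => //= z; rewrite /ball_ /= distrC => /ltW/cx.
  rewrite addrC subrK => /and3P[d0 dz zd]; rewrite IH//; lra.
case=> _; have [_ ->] := d1 => /oppr_inj.
by apply: mulfI; rewrite pnatr_eq0.
Qed.

End CotangentExpansion.

(** * Dirichlet series *)

Section Character.
Variables (R : realType) (N : nat).
Hypothesis hN : (1 < N)%N.
Variable chi : {unit 'Z_N} -> R[i].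

Lemma char_ext_mod (a b : int) : a%:~R = b%:~R :> 'Z_N ->
  char_ext chi a = char_ext chi b.
Proof. by rewrite /char_ext => ->. Qed.

Lemma char_ext_addM m k : char_ext chi (k * N + m)%N%:Z = char_ext chi m%:Z.
Proof. by apply: char_ext_mod; rewrite -!pmulrn natrD natrM pchar_Zp// mulr0 add0r. Qed.

Lemma char_ext_period0 : char_ext chi N%:Z = 0.
Proof.
by rewrite /char_ext -pmulrn pchar_Zp//; case: insubP => //= u; rewrite unitr0.
Qed.

Lemma char_ext_opp (a : int) : dirichlet_character chi ->
  char_ext chi (- a) = char_ext chi (-1) * char_ext chi a.
Proof.
move=> [chiM _]; rewrite /char_ext.
have -> : (- a)%:~R = (-1)%:~R * a%:~R :> 'Z_N by rewrite -intrM mulN1r.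
case: insubP => [w wU wE|nU].
  case: insubP => [u _ uE|/negP[]]; last by rewrite rmorphN1 unitrN1.
  case: insubP => [v _ vE|/negP[]]; last first.
    by move: wU; rewrite rmorphN1 mulN1r unitrN.
  by rewrite /= -chiM; congr chi; apply: val_inj; rewrite wE /= uE vE.
case: (insubP _ (a%:~R : 'Z_N)) => [v vU _|_]; last by rewrite mulr0.
by move: nU; rewrite rmorphN1 mulN1r unitrN vU.
Qed.

(** The group is finite, so the sum of all moduli serves as a crude bound. *)
Lemma char_ext_bounded : exists B : R[i], forall a, `|char_ext chi a| <= B.
Proof.
exists (\sum_u `|chi u|) => a; rewrite /char_ext.
case: insubP => [u _ _|_] /=; last by rewrite normr0 sumr_ge0.
by rewrite (bigD1 u)//= lerDl sumr_ge0.
Qed.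

End Character.

(** * Limits of complex sequences *)

Section ComplexLimits.
Local Open Scope classical_set_scope.
Variable R : realType.

Lemma normc_real (x : R) : `|x%:C| = `|x|%:C.
Proof. by rewrite normc_def /= expr0n addr0 sqrtr_sqr. Qed.

Lemma cvg_real_complex (u : R^nat) (l : R) :
  u @ \oo --> l -> (fun k => (u k)%:C : R[i]^o) @ \oo --> (l%:C : R[i]^o).
Proof.
move=> ul; apply/cvgrPdist_lt => e e0.
have [r er] : exists r, e = r%:C by apply/complex_realP/gtr0_real.
rewrite er ltcR in e0; near=> k.
rewrite er -rmorphB normc_real ltcR.
by near: k; move/cvgrPdist_lt : ul; apply.
Unshelve. all: by end_near. Qed.

Lemma cvg_divn N : (0 < N)%N -> (fun k => k %/ N)%N @ \oo --> \oo.
Proof.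
move=> N0 P [K _ HP]; exists (K * N)%N => // k /= Kk.
by apply: HP; rewrite /= leq_divRL.
Qed.

(* The terms of the series are O(1/k), so that convergence along the multiples
   of N is enough. *)
Lemma cvg_series_from_multiples (u : (R[i]^o)^nat) (B : R[i]) N (l : R[i]^o) :
  (0 < N)%N ->
  (forall k, `|u k| <= B * k.+1%:R^-1) ->
  (fun K => series u (K * N)%N) @ \oo --> l -> series u @ \oo --> l.
Proof.
move=> N0 uB ul.
have B0 : 0 <= B.
  by have := uB 0%N; rewrite invr1 mulr1; apply: le_trans.
(* Fewer than N terms lie between the two partial sums, and their indices are at least k %/ N, so
   each is at most B / (k %/ N + 1). *)
have D : (fun k => series u k - series u (k %/ N * N)%N) @ \oo --> (0 : R[i]^o).
  have h0 : (fun k => (((k %/ N).+1%:R^-1 : R)%:C) : R[i]^o) @ \oo --> (0 : R[i]^o).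
    apply: (@cvg_real_complex (fun k => (k %/ N).+1%:R^-1) 0).
    by apply: (@cvg_comp _ _ _ (fun k => k %/ N)%N (@harmonic R) _ _ _ (cvg_divn N0)); exact: cvg_harmonic.
  have e0 : (fun k => (N%:R * B) *: (((k %/ N).+1%:R^-1 : R)%:C : R[i]^o)) @ \oo -->
      (0 : R[i]^o).
    by rewrite -[X in _ --> X](scaler0 _ (N%:R * B)); exact: cvgZl_tmp.
  apply/cvgr0Pnorm_le => e e_gt0; near=> k.
  apply: (@le_trans _ _ `|(N%:R * B) *: (((k %/ N).+1%:R^-1 : R)%:C : R[i]^o)|); last first.
    by near: k; move/cvgr0Pnorm_le : e0; apply.
  rewrite sub_series_geq ?leq_divM//.
  apply: le_trans (ler_norm_sum _ _ _) _.
  rewrite normrZ ger0_norm ?mulr_ge0// normc_real ger0_norm ?invr_ge0//.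
  rewrite fmorphV rmorph_nat /=.
  apply: (@le_trans _ _ (\sum_(k %/ N * N <= i < k) B * (k %/ N).+1%:R^-1)).
    apply: ler_sum_nat => i /andP[ki _]; apply: le_trans (uB i) _.
    apply: ler_wpM2l => //; rewrite lef_pV2 ?posrE ?ltr0n// ler_nat ltnS.
    by apply: leq_trans ki; rewrite leq_pmulr.
  rewrite sumr_const_nat -[leLHS]mulr_natl -[leRHS]mulrA ler_wpM2r ?mulr_ge0 ?invr_ge0//.
  by rewrite ler_nat; rewrite {1}(divn_eq k N) addKn ltnW// ltn_mod.
have -> : series u = (fun k => (series u k - series u (k %/ N * N)%N) +
   series u (k %/ N * N)%N) by apply/funext => k; rewrite subrK.
rewrite -[X in _ --> X]add0r. apply: cvgD; first exact: D.
have uc : (fun K => series u (K * N)%N) \o (fun k => k %/ N)%N @ \oo --> l.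
  by apply: cvg_comp ul; exact: cvg_divn.
exact: uc.
Unshelve. all: by end_near. Qed.

End ComplexLimits.

Lemma cvg_sum_seq (K : numFieldType) (V : normedModType K) (I : Type)
    (r : seq I) (P : pred I) (u : I -> V^nat) (l : I -> V) :
  (forall i, P i -> (u i @ \oo --> l i)%classic) ->
  ((fun n => \sum_(i <- r | P i) u i n) @ \oo -->
     \sum_(i <- r | P i) l i)%classic.
Proof.
move=> ul; elim: r => [|i r IH].
  by rewrite big_nil; under eq_fun do rewrite big_nil; exact: cvg_cst.
rewrite big_cons; under eq_fun do rewrite big_cons.
by case: ifP => // /ul ?; exact: cvgD.
Qed.

Section DirichletSeries.
Local Open Scope classical_set_scope.
Variables (R : realType) (N : nat).
Hypothesis hN : (1 < N)%N.
Variable chi : {unit 'Z_N} -> R[i].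
Hypothesis hchi : dirichlet_character chi.
Let N0 : (0 < N)%N. Proof. exact: ltnW. Qed.

(* Folding the blocks of length N of the series by the reflection m -> N - m. *)
Lemma dirichlet_series_fold n K : char_ext chi (-1) = (-1) ^+ n ->
  2 * dirichlet_series chi n (K * N)%N =
  \sum_(1 <= m < N) char_ext chi m%:Z *
    (N%:R ^- n * series (lattice_term n (m%:R / N%:R : R)) K)%:C.
Proof.
move=> chiN; rewrite /dirichlet_series /series /=.
have n0 : N%:R != 0 :> R by rewrite pnatr_eq0 -lt0n.
elim: K => [|K IH].
  by rewrite mul0n big_nil mulr0 big1// => m _; rewrite big_nil mulr0 mulr0.
rewrite mulSnr (@big_cat_nat _ _ _ (K * N)%N) ?leq_addr//= mulrDr IH.
under [RHS]eq_bigr do rewrite big_nat_recr//= mulrDr rmorphD mulrDr.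
rewrite big_split; congr (_ + _).
rewrite -{1}[(K * N)%N]add0n big_addn addKn.
pose F m : R[i] := char_ext chi m%:Z / (K * N + m)%:R ^+ n.
(* The shifted index makes the block run over m = 1, ..., N, and m = N contributes 0. *)
have -> : \sum_(0 <= i < N) char_ext chi (i + K * N).+1 / (i + K * N).+1%:R ^+ n =
    \sum_(1 <= m < N) F m.
  transitivity (\sum_(1 <= m < N.+1) F m).
    rewrite big_add1; apply: eq_bigr => i _; rewrite /F.
    by rewrite addnC -addnS (char_ext_addM hN).
  by rewrite big_nat_recr//= {2}/F (char_ext_period0 hN) mul0r addr0.
(* Of the two copies of the block, one is reversed by m -> N - m. *)
rewrite mulr2n mulrDl mul1r {2}big_nat_rev -big_split /=.
apply: eq_big_nat => m /andP[m1 mN].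
have E : char_ext chi (N - m)%:Z = (-1) ^+ n * char_ext chi m%:Z.
  rewrite -chiN -char_ext_opp//; apply: char_ext_mod.
  by rewrite rmorphN /= -!pmulrn natrB ?(ltnW mN)// pchar_Zp// sub0r.
(* N (m/N - K - 1) = -(K N + N - m), and the sign (-1)^n matches the parity of chi. *)
have -> : N%:R ^- n * lattice_term n (m%:R / N%:R) K =
    (K * N + m)%:R ^- n + (-1) ^+ n * (K * N + (N - m))%:R ^- n :> R.
  have S z : (-1) ^+ n * z ^- n = (- z)^-1 ^+ n :> R.
    by rewrite invrN [RHS]exprNn exprVn.
  rewrite S /lattice_term mulrDr -!exprVn -!exprMn -!invfM.
  congr (_^-1 ^+ n + _^-1 ^+ n).
    by rewrite natrD natrM; field.
  by rewrite !natrD natrB ?(ltnW mN)// natrM -[K.+1%:R]natr1; field.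
rewrite /F add1n subSS E; move: (K * N + m)%N (K * N + (N - m))%N => p q.
have C k : (k%:R ^- n : R)%:C = k%:R ^- n by rewrite fmorphV rmorphXn rmorph_nat.
rewrite rmorphD rmorphM /= !C rmorphXn /= rmorphN1.
by rewrite mulrDr mulrCA mulrA.
Qed.

(** Along multiples of N the folding leaves a finite combination of lattice series, convergent even
    at exponent 1. The bound k^-(n+1) <= k^-1 then reaches all partial sums. *)
Lemma cvg_dirichlet_series n : char_ext chi (-1) = (-1) ^+ n.+1 ->
  dirichlet_series chi n.+1 @ \oo -->
    (2^-1 * \sum_(1 <= m < N) char_ext chi m%:Z *
      (N%:R ^- n.+1 * cot_deriv n (m%:R / N%:R : R))%:C : R[i]^o).
Proof.
move=> chiN.
have [B HB] := char_ext_bounded chi.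
have B0 : 0 <= B by apply: le_trans (HB 0); exact: normr_ge0.
apply: (@cvg_series_from_multiples R _ B N _ N0) => [k|].
  rewrite normrM normfV normrX [`|k.+1%:R|]ger0_norm//.
  apply: ler_pM => //.
  rewrite exprS invfM ler_piMr ?invr_ge0// invf_le1 ?exprn_gt0 ?ltr0n//.
  by rewrite exprn_ege1// ler1n.
have -> : (fun K => dirichlet_series chi n.+1 (K * N)%N) = fun K =>
    2^-1 *: (\sum_(1 <= m < N) char_ext chi m%:Z *:
    ((N%:R ^- n.+1 * series (lattice_term n.+1 (m%:R / N%:R : R)) K)%:C : R[i]^o)).
  apply/funext => K; rewrite /GRing.scale /= -(dirichlet_series_fold K chiN).
  by rewrite mulKf// pnatr_eq0.
apply: cvgZl_tmp.
rewrite big_seq; under eq_fun do rewrite big_seq.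
apply: cvg_sum_seq => m; rewrite mem_index_iota => /andP[m0 mN].
apply: cvgZl_tmp.
apply: (@cvg_real_complex R (fun K => N%:R ^- n.+1 *
  series (lattice_term n.+1 (m%:R / N%:R)) K)).
have x01 : 0 < (m%:R / N%:R : R) < 1.
  by rewrite divr_gt0 ?ltr0n//= ltr_pdivrMr ?ltr0n// mul1r ltr_nat.
by rewrite -lattice_sumE//; apply: cvgMl_tmp; exact: cvg_lattice_sum.
Qed.

End DirichletSeries.

Theorem theorem3p1 (R : realType) (N : nat) (hN : (2 < N)%N)
    (chi : {unit 'Z_N} -> R[i]) (hchi : dirichlet_character chi) :
  (forall n : nat, (2 <= n)%N -> char_ext chi (-1) = (-1) ^+ n ->
     cvgn (dirichlet_series chi n) /\
     dirichlet_L chi n =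
       (pi ^+ n / (2 * (n.-1)`!%:R * N%:R ^+ n))%:C *
       \sum_(1 <= m < N.+1)
         char_ext chi m%:Z / (sin (m%:R * pi / N%:R) ^+ n)%:C *
         \sum_(1 <= l < n)
           (cos ((n%:R - 2 * l%:R) * m%:R * pi / N%:R) *
            (circular_eulerian n l)%:R)%:C)
  /\
  (char_ext chi (-1) = -1 ->
     cvgn (dirichlet_series chi 1) /\
     dirichlet_L chi 1 =
       (pi / (2 * N%:R))%:C *
       \sum_(1 <= m < N.+1)
         char_ext chi m%:Z * (cot (m%:R * pi / N%:R))%:C).
Proof.
have N1 : (1 < N)%N by exact: ltnW.
have N0 : (0 < N)%N by exact: ltnW.
have pE m : pi * (m%:R / N%:R) = m%:R * pi / N%:R :> R by rewrite mulrA (mulrC pi).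
split=> [[|[|n]]// _ chiN|chiN].
  have := cvg_dirichlet_series N1 hchi chiN; set L := _ * _ => cvL.
  split; first exact: cvgP cvL.
  rewrite /dirichlet_L (cvg_lim _ cvL)//.
  (* The term m = N, where the sine vanishes, is 0 because chi(N) = 0. *)
  rewrite big_nat_recr//= char_ext_period0// !mul0r addr0 /L.
  rewrite !mulr_sumr; apply: eq_bigr => m _.
  under eq_bigr => l _ do rewrite -!mulrA (mulrA m%:R) -pE.
  rewrite -rmorph_sum sum_circular_eulerian.
  rewrite /cot_deriv /euler_cos pE.
  have -> : (2^-1 : R[i]) = (2^-1 : R)%:C by rewrite fmorphV rmorph_nat.
  rewrite -fmorphV (invfM (2 * _)) (invfM 2).
  move: (pi ^+ _) (_ `!%:R^-1) (N%:R ^- _) (sin _ ^- _) (\sum_(s in _) _).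
  by move=> P F M S E; rewrite /= !rmorphM /=; ring.
have := cvg_dirichlet_series (n := 0) N1 hchi chiN; set L := _ * _ => cvL.
split; first exact: cvgP cvL.
rewrite /dirichlet_L (cvg_lim _ cvL)//.
rewrite big_nat_recr//= char_ext_period0// mul0r addr0 /L.
rewrite !mulr_sumr; apply: eq_bigr => m _.
rewrite cot_deriv0 pE expr1.
have -> : (2^-1 : R[i]) = (2^-1 : R)%:C by rewrite fmorphV rmorph_nat.
rewrite invfM; move: pi (N%:R^-1) (cot _) => P M c.
by rewrite !rmorphM /=; ring.
Qed.
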